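(* Let $F$ be the field of $2$ elements, let $G$ be a finite $2$-group of order at most $16$, and let $H$ be a $2$-group of order at most $16$. Then $V_*(FG)\cong V_*(FH)$ (as groups) if and only if $G\cong H$.
   Context: For a finite group $G$ and a field $F$, $FG$ denotes the group algebra. The augmentation of $x=\sum_{g\in G}\alpha_g g\in FG$ is $\chi(x)=\sum_{g\in G}\alpha_g$, and $V(FG)$ denotes the normalized unit group of $FG$, i.e. the group of units of $FG$ with augmentation $1$. The classical involution $*$ on $FG$ is the $F$-linear map with $g^*=g^{-1}$ for all $g\in G$. An element $u\in V(FG)$ is called unitary if $u^{-1}=u^*$. The unitary subgroup $V_*(FG)$ is the subgroup of $V(FG)$ consisting of all unitary elements. *)

(* Defs.v *)
From HB Require Import structures.
From mathcomp Require Import all_boot all_order all_algebra all_fingroup all_solvable.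

Set Implicit Arguments.
Unset Strict Implicit.
Unset Printing Implicit Defensive.

Import GRing.Theory.
Local Open Scope ring_scope.

(* x : groupAlg F gT is the formal sum of the (x g) g.  A new name for the    *)
(* type of functions, because the library multiplies functions pointwise.     *)
Definition groupAlg (F : fieldType) (gT : finGroupType) : Type :=
  {ffun gT -> F}.

Section GroupAlgebra.

Variables (F : fieldType) (gT : finGroupType).
Local Notation FG := (groupAlg F gT).
Implicit Types (x y z : FG) (g h : gT).

HB.instance Definition _ := GRing.Lmodule.copy FG {ffun gT -> F^o}.

Definition ga_of g : FG := [ffun h => (h == g)%:R].

Definition ga_mul x y : FG :=
  [ffun g => \sum_h x h * y (h^-1 * g)%g].

Lemma ga_ofE g h : ga_of g h = (h == g)%:R.
Proof. by rewrite ffunE. Qed.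

Lemma ga_mulfE x y g : ga_mul x y g = \sum_h x h * y (h^-1 * g)%g.
Proof. by rewrite ffunE. Qed.

Lemma ga_addE x y g : (x + y) g = x g + y g.
Proof. by rewrite ffunE. Qed.

Lemma ga_scaleE (a : F) x g : (a *: x) g = a * x g.
Proof. by rewrite ffunE. Qed.

Lemma ga_sumE (I : Type) (r : seq I) (P : pred I) (X : I -> FG) g :
  (\sum_(i <- r | P i) X i) g = \sum_(i <- r | P i) X i g.
Proof. by rewrite sum_ffunE. Qed.

Lemma gaP x y : (forall g, x g = y g) -> x = y.
Proof. by move=> exy; apply/ffunP. Qed.

Fact ga_mulA : associative ga_mul.
Proof.
move=> x y z; apply: gaP => g; rewrite !ga_mulfE.
under eq_bigr => h _ do rewrite ga_mulfE mulr_sumr.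
under [RHS]eq_bigr => h _ do rewrite ga_mulfE mulr_suml.
rewrite [RHS]exchange_big /=; apply: eq_bigr => h _.
rewrite (reindex_inj (mulgI h^-1)%g) /=; apply: eq_bigr => k _.
by rewrite mulrA !invgM invgK !mulgA mulgK.
Qed.

Fact ga_mul1 : left_id (ga_of 1%g) ga_mul.
Proof.
move=> x; apply: gaP => g; rewrite ga_mulfE (bigD1 1%g) //= ga_ofE eqxx mul1r.
rewrite invg1 mul1g big1 ?addr0 // => h /negPf nh.
by rewrite ga_ofE nh mul0r.
Qed.

Fact ga_mulr1 : right_id (ga_of 1%g) ga_mul.
Proof.
move=> x; apply: gaP => g; rewrite ga_mulfE (bigD1 g) //= ga_ofE mulVg eqxx.
rewrite mulr1 big1 ?addr0 // => h nh.
rewrite ga_ofE -eq_mulVg1 (negPf nh) mulr0 //.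
Qed.

Fact ga_mulDl : left_distributive ga_mul +%R.
Proof.
move=> x y z; apply: gaP => g; rewrite ga_addE !ga_mulfE -big_split /=.
by apply: eq_bigr => h _; rewrite ga_addE mulrDl.
Qed.

Fact ga_mulDr : right_distributive ga_mul +%R.
Proof.
move=> x y z; apply: gaP => g; rewrite ga_addE !ga_mulfE -big_split /=.
by apply: eq_bigr => h _; rewrite ga_addE mulrDr.
Qed.

Fact ga_oner_neq0 : ga_of 1%g != 0.
Proof.
apply/eqP => /(congr1 (fun x : FG => x 1%g)) /eqP.
by rewrite ga_ofE eqxx ffunE oner_eq0.
Qed.

HB.instance Definition _ := GRing.Zmodule_isNzRing.Build FG
  ga_mulA ga_mul1 ga_mulr1 ga_mulDl ga_mulDr ga_oner_neq0.

Lemma ga_mulE x y g : (x * y) g = \sum_h x h * y (h^-1 * g)%g.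
Proof. exact: ga_mulfE. Qed.

Fact ga_scaleAl (a : F) x y : a *: (x * y) = (a *: x) * y.
Proof.
apply: gaP => g; rewrite ga_scaleE !ga_mulE mulr_sumr.
by apply: eq_bigr => h _; rewrite ga_scaleE mulrA.
Qed.

HB.instance Definition _ := GRing.Lmodule_isLalgebra.Build F FG ga_scaleAl.

Fact ga_scaleAr (a : F) x y : a *: (x * y) = x * (a *: y).
Proof.
apply: gaP => g; rewrite ga_scaleE !ga_mulE mulr_sumr.
by apply: eq_bigr => h _; rewrite ga_scaleE mulrCA.
Qed.

HB.instance Definition _ := GRing.Lalgebra_isAlgebra.Build F FG ga_scaleAr.

Lemma ga_of1 : ga_of 1%g = 1.
Proof. by []. Qed.

Lemma ga_ofM g h : ga_of (g * h)%g = ga_of g * ga_of h.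
Proof.
apply: gaP => k; rewrite ga_mulE (bigD1 g) //= !ga_ofE eqxx mul1r big1.
  by rewrite addr0 -(inj_eq (mulgI g^-1%g)) mulKg.
by move=> l /negPf nl; rewrite ga_ofE nl mul0r.
Qed.

Lemma ga_sum_of x : x = \sum_g x g *: ga_of g.
Proof.
apply: gaP => g; rewrite ga_sumE (bigD1 g) //= ga_scaleE ga_ofE eqxx mulr1.
rewrite big1 ?addr0 // => h /negPf nh.
by rewrite ga_scaleE ga_ofE eq_sym nh mulr0.
Qed.

Definition ga_aug x : F := \sum_g x g.

Definition ga_star x : FG := \sum_g x g *: ga_of g^-1%g.

Lemma ga_starE x g : ga_star x g = x g^-1%g.
Proof.
rewrite ga_sumE (bigD1 g^-1%g) //= ga_scaleE ga_ofE invgK eqxx mulr1.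
rewrite big1 ?addr0 // => h nh.
by rewrite ga_scaleE ga_ofE -(inj_eq invg_inj) invgK eq_sym (negPf nh) mulr0.
Qed.

Lemma ga_star_linear : linear ga_star.
Proof.
by move=> a x y; apply: gaP => g; rewrite !(ga_addE, ga_scaleE, ga_starE).
Qed.

Lemma ga_star_of g : ga_star (ga_of g) = ga_of g^-1%g.
Proof.
by apply: gaP => h; rewrite ga_starE !ga_ofE -(inj_eq invg_inj) invgK.
Qed.

Lemma ga_starM x y : ga_star (x * y) = ga_star y * ga_star x.
Proof.
apply: gaP => g; rewrite ga_starE !ga_mulE.
rewrite (reindex_inj (mulgI g^-1)%g) /=; apply: eq_bigr => h _.
by rewrite !ga_starE mulrC !invgM !invgK -mulgA mulgV mulg1.
Qed.

Lemma ga_starK : involutive ga_star.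
Proof. by move=> x; apply: gaP => g; rewrite !ga_starE invgK. Qed.

Lemma ga_star1 : ga_star 1 = 1.
Proof. by rewrite -ga_of1 ga_star_of invg1. Qed.

Lemma ga_aug_of g : ga_aug (ga_of g) = 1.
Proof.
rewrite /ga_aug (bigD1 g) //= ga_ofE eqxx big1 ?addr0 // => h /negPf nh.
by rewrite ga_ofE nh.
Qed.

Lemma ga_aug1 : ga_aug 1 = 1.
Proof. exact: ga_aug_of. Qed.

Lemma ga_augM x y : ga_aug (x * y) = ga_aug x * ga_aug y.
Proof.
rewrite /ga_aug; under eq_bigr => g _ do rewrite ga_mulE.
rewrite exchange_big mulr_suml /=; apply: eq_bigr => h _.
rewrite -mulr_sumr (reindex_inj (mulgI h)) /=; congr (_ * _).
by apply: eq_bigr => g _; rewrite mulKg.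
Qed.

End GroupAlgebra.

(* The unit group {unit FG} is available in the library as a finite group,    *)
(* hence the restriction to finite coefficient fields from here on.           *)
Section UnitarySubgroup.

Variables (F : finFieldType) (gT : finGroupType).
Local Notation FG := (groupAlg F gT).

HB.instance Definition _ := Finite.copy FG {ffun gT -> F}.
HB.instance Definition _ := FinRing.isNzRing.Build FG.

Definition normUnits : {set {unit FG}} := [set u | ga_aug (val u) == 1].

Fact normUnits_group_set : group_set normUnits.
Proof.
apply/group_setP; split=> [|u v]; first by rewrite inE ga_aug1.
by rewrite !inE ga_augM => /eqP-> /eqP->; rewrite mulr1.
Qed.

Canonical normUnits_group := Group normUnits_group_set.

Definition unitarySubgroup : {set {unit FG}} :=
  [set u in normUnits | val (u^-1)%g == ga_star (val u)].

Fact unitarySubgroup_group_set : group_set unitarySubgroup.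
Proof.
apply/group_setP; split=> [|u v].
  by rewrite inE group1 invg1 ga_star1 /=.
rewrite inE => /andP[Vu /eqP uu]; rewrite inE => /andP[Vv /eqP uv].
by rewrite inE groupM // invgM !FinRing.val_unitM ga_starM -uu -uv eqxx.
Qed.

Canonical unitarySubgroup_group := Group unitarySubgroup_group_set.

End UnitarySubgroup.

Arguments normUnits F gT : clear implicits.
Arguments unitarySubgroup F gT : clear implicits.

(* Main.v *)
Require Import Defs.
From mathcomp Require Import all_boot all_order all_algebra all_fingroup all_solvable.
From Stdlib Require BinNat.

Set Implicit Arguments.
Unset Strict Implicit.
Unset Printing Implicit Defensive.

Import GRing.Theory.

(** Functoriality of the group algebra gives one direction.  For the other,
    write V for the unitary subgroup of F_2[G].  Four isomorphism invariants of
    V can be read off G, and together they separate the 23 isomorphism types of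
    2-groups of order at most 16.

    - The number of u in V with u^2 = 1.  Such a u equals its own inverse, so it
      is fixed by the involution and u = 1 + y with y symmetric, of augmentation
      0 and with y^2 = 0; conversely every such y gives a u
      ([card_involutions]).  The symmetric elements of augmentation 0 have the
      basis g + g^-1 (for g^2 <> 1), g + 1 (for g^2 = 1, g <> 1), and squaring
      is a quadratic map on this space, since in characteristic 2 the square of
      a sum is the sum of the squares and of the brackets ab + ba.  Its zeros
      are counted by running through the combinations of the basis
      ([null_squaresP], [involution_countP]).
    - Commutativity of V, which is that of G ([ga_abelianP]).
    - When V is commutative, whether its exponent divides 4; by the Frobenius
      map this is so exactly when the exponent of G divides 4
      ([ga_exponent4P]).
    - Whether all involutions of V are central.  They are when every conjugate
      of any g in G is g or g^-1 ([involutions_central]); they are not when some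
      g with g^4 = 1 has another conjugate, because then g or 1 + g + g^-1 is a
      noncentral involution ([involution_not_central]).  Each of the 23 groups
      falls under one of these two cases.

    The first two invariants leave only three collisions: C2 x C2 with C8 and
    C4 x C2 with C16, which differ in the third, and Q8 x C2 with the
    nonabelian C4 : C4, which differ in the fourth.

    That there are no more than 23 types is obtained from polycyclic
    presentations.  A group of order 2^n has a chain of normal subgroups with
    factors of order 2, and choosing a generator of each factor writes its
    elements as bit words of length n.  Multiplication is then determined by a
    code: for each generator a, the word of a^2 and the words of the conjugates
    by a of the later generators ([pc_series], [pc_mulP]).  For n <= 4 there are
    finitely many codes; discarding those that violate associativity and finding
    in each remaining one a generating system for one of 23 chosen codes is a
    finite computation ([classification]). *)

(** * Bit words and polycyclic codes *)

Fixpoint bits n : seq (seq bool) :=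
  if n is n'.+1 then map (cons false) (bits n') ++ map (cons true) (bits n')
  else [:: [::]].

Lemma size_bits n : size (bits n) = 2 ^ n.
Proof.
by elim: n => //= n IHn; rewrite size_cat !size_map IHn expnS mul2n addnn.
Qed.

Lemma mem_bits n x : (x \in bits n) = (size x == n).
Proof.
elim: n x => [|n IHn] [|[] x] //=; rewrite mem_cat.
- by apply/norP; split; apply/mapP => -[].
- rewrite eqSS -IHn (mem_map (f := cons true)); last by move=> ? ? [].
  by rewrite orb_idl // => /mapP[].
- rewrite eqSS -IHn (mem_map (f := cons false)); last by move=> ? ? [].
  by rewrite orb_idr // => /mapP[].
Qed.

Lemma bits_uniq n : uniq (bits n).
Proof.
elim: n => //= n IHn; rewrite cat_uniq !map_inj_uniq ?IHn; try by move=> ? ? [].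
by rewrite andbT -all_predC; apply/allP => _ /mapP[x _ ->]; apply/mapP => -[].
Qed.

Lemma enum_by_bits (T : finType) (K : {pred T}) n (f : seq bool -> T) :
    #|K| = 2 ^ n -> {subset K <= map f (bits n)} ->
  perm_eq (map f (bits n)) (enum K).
Proof.
move=> cK sK.
have sub : {subset enum K <= map f (bits n)}.
  by move=> k; rewrite mem_enum; apply: sK.
have le : size (map f (bits n)) <= size (enum K).
  by rewrite size_map size_bits -cardE cK.
have [_ eqm] := uniq_min_size (enum_uniq _) sub le.
rewrite perm_sym uniq_perm ?enum_uniq //.
exact: leq_size_uniq (enum_uniq _) sub le.
Qed.

Lemma uniq_map_inj (T1 T2 : eqType) (f : T1 -> T2) s :
  uniq (map f s) -> {in s &, injective f}.
Proof.
move=> Ufs x y xs ys fxy; have U := elimT (uniqP (f x)) Ufs.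
rewrite -(nth_index x xs) -[RHS](nth_index x ys); congr nth.
apply: U; rewrite ?inE ?size_map ?index_mem //.
by rewrite !(nth_map x) ?index_mem ?nth_index.
Qed.

Section Words.

Variables (T : eqType) (mul : T -> T -> T) (one : T).

Fixpoint word (gs : seq T) (x : seq bool) : T :=
  match gs, x with
  | g :: gs', b :: x' => if b then mul g (word gs' x') else word gs' x'
  | _, _ => one
  end.

(** A code lists, from the top generator a down, the word m of a^2 and the words
    s of the conjugates k^a of the later generators k; words are in the later
    generators only. *)
Definition pc_code := seq (seq bool * seq (seq bool)).

(** The conjugation relations are written k a = a w rather than a^-1 k a = w, so
    that they also make sense in a code, where no inverse is available. *)
Definition step_relations m s g gs :=
  (mul g g == word gs m) &&
  ([seq mul k g | k <- gs] == [seq mul g (word gs t) | t <- s]).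

Fixpoint presents (c : pc_code) (gs : seq T) : bool :=
  match c, gs with
  | (m, s) :: c', g :: gs' => step_relations m s g gs' && presents c' gs'
  | [::], [::] => true
  | _, _ => false
  end.

Lemma word_ind (P : pred T) gs x :
  P one -> {in P &, forall a b, P (mul a b)} -> all P gs -> P (word gs x).
Proof.
move=> P1 PM; elim: gs x => [|g gs IHgs] [|b x] //= /andP[Pg Pgs].
by case: b; [apply: PM | ] => //; apply: IHgs.
Qed.

End Words.

Section WordMorphism.

Variables (T U : eqType) (mulT : T -> T -> T) (oneT : T).
Variables (mulU : U -> U -> U) (oneU : U) (f : T -> U).
Hypotheses (f1 : f oneT = oneU) (fM : {morph f : a b / mulT a b >-> mulU a b}).

Lemma word_morph gs x : f (word mulT oneT gs x) = word mulU oneU (map f gs) x.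
Proof.
by elim: gs x => [|g gs IHgs] [|b x] //=; case: b; rewrite ?fM IHgs.
Qed.

Lemma presents_morph c gs :
  presents mulT oneT c gs -> presents mulU oneU c (map f gs).
Proof.
elim: c gs => [|[m s] c IHc] [|g gs] //= /andP[/andP[/eqP gg /eqP gk] /IHc->].
rewrite andbT /step_relations -fM gg word_morph eqxx /= -map_comp.
have/(congr1 (map f)) := gk; rewrite -!map_comp => e; apply/eqP.
rewrite [LHS](_ : _ = [seq (f \o mulT^~ g) k | k <- gs]).
  by rewrite e; apply: eq_map => t /=; rewrite fM word_morph.
by apply: eq_map => k /=; rewrite fM.
Qed.

End WordMorphism.

Definition pc_one (c : pc_code) := nseq (size c) false.

(** Collection: (a^i x)(a^j y) = a^(i+j) x' y, where x' is x or its conjugate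
    by a, followed by a factor a^2 when i = j = 1.  Missing bits are read as 0,
    which is what makes [pc_mulP] hold for words of any length. *)
Fixpoint pc_mul (c : pc_code) (x y : seq bool) : seq bool :=
  match c, x, y with
  | (m, s) :: c', i :: x', j :: y' =>
    let xj := if j then word (pc_mul c') (pc_one c') s x' else x' in
    let z := pc_mul c' xj y' in
    (i (+) j) :: (if i && j then pc_mul c' m z else z)
  | _, [::], _ => y
  | _, _, _ => x
  end.

Local Notation gword := (word (@mulg _) 1%g).
Local Notation gpresents := (presents (@mulg _) 1%g).

Section PcMul.

Variable gT : finGroupType.
Implicit Types gs : seq gT.
Local Open Scope group_scope.

Lemma gword0 gs n : gword gs (nseq n false) = 1.
Proof. by elim: gs n => [|g gs IHgs] [|n] /=. Qed.

Lemma gword_conj gs x h : gword gs x ^ h = gword [seq g ^ h | g <- gs] x.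
Proof.
by apply: (word_morph (f := conjg^~ h)) => [|a b]; rewrite ?conj1g ?conjMg.
Qed.

Lemma pc_mulP c gs : gpresents c gs ->
  {morph gword gs : x y / pc_mul c x y >-> x * y}.
Proof.
elim: c gs => [|[m s] c IHc] [|g gs] //=; first by move=> _ x y /=; rewrite mulg1.
case/andP=> /andP[/eqP gg /eqP gk] /[dup] pc /IHc W [|i x] [|j y] //=;
  rewrite ?mulg1 ?mul1g //.
have xg u : gword gs u * g = g * gword gs (word (pc_mul c) (pc_one c) s u).
  rewrite (word_morph (gword0 gs _) W).
  have -> : map (gword gs) s = [seq k ^ g | k <- gs].
    have/(congr1 (map (mulg g^-1))) := gk; rewrite -!map_comp => e.
    rewrite (@eq_map _ _ (conjg^~ g) (mulg g^-1 \o mulg^~ g)) ?e.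
      by apply: eq_map => t /=; rewrite mulKg.
    by move=> k /=; rewrite conjgE.
  by rewrite -gword_conj conjgE mulVKg.
by case: i j => [] [] /=; rewrite ?W -?gg -?mulgA // ?(mulgA _ g) xg !mulgA.
Qed.

End PcMul.

Fixpoint wf_code (c : pc_code) :=
  if c is (m, s) :: c' then
    [&& size m == size c', all (fun t => size t == size c') s & wf_code c']
  else true.

Lemma size_pc_mul c x y :
  wf_code c -> size x = size c -> size y = size c -> size (pc_mul c x y) = size c.
Proof.
elim: c x y => [|[m s] c IHc] [|i x] [|j y] //= /and3P[/eqP sm ss wc] [sx] [sy].
have sxj : size (if j then word (pc_mul c) (pc_one c) s x else x) = size c.
  case: j => //; apply/eqP; apply: (word_ind (P := fun t => size t == size c)) ss.
    by rewrite size_nseq.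
  by move=> a b /eqP sa /eqP sb; rewrite /= IHc.
by congr _.+1; case: (i && j); rewrite !IHc // IHc.
Qed.

(** Words of the conjugates of n generators under an element that acts trivially
    on each factor of the chain: the k-th one is the k-th generator times a word
    in the later ones. *)
Fixpoint triangular n : seq (seq (seq bool)) :=
  if n is n'.+1 then
    [seq (true :: t) :: map (cons false) s | t <- bits n', s <- triangular n']
  else [:: [::]].

Fixpoint codes n : seq pc_code :=
  if n is n'.+1 then
    flatten [seq [seq (m, s) :: c | m <- bits n', s <- triangular n']
                | c <- codes n']
  else [:: [::]].

Lemma triangular_size n s : s \in triangular n -> all (fun t => size t == n) s.
Proof.
elim: n s => [|n IHn] s /=; first by rewrite inE => /eqP->.
case/allpairsP=> -[t u] /= [bt /IHn /allP su ->] /=.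
rewrite eqSS -mem_bits bt all_map; apply/allP => v /su /=.
by rewrite eqSS.
Qed.

Lemma codesP n c : c \in codes n -> size c = n /\ wf_code c.
Proof.
elim: n c => [|n IHn] c /=; first by rewrite inE => /eqP->.
case/flattenP=> _ /mapP[d /IHn[sd wd] ->] /allpairsP[[m s] /= [bm ts ->]] /=.
by rewrite sd wd -mem_bits bm triangular_size.
Qed.

Lemma mem_codesS n m s c :
    m \in bits n -> s \in triangular n -> c \in codes n ->
  (m, s) :: c \in codes n.+1.
Proof.
move=> bm ts cc /=; apply/flattenP.
exists [seq (m, s) :: c | m <- bits n, s <- triangular n]; first exact: map_f.
by apply/allpairsP; exists (m, s).
Qed.

(** * Polycyclic systems in a finite 2-group *)
Section PcSystems.

Variable gT : finGroupType.
Implicit Types gs : seq gT.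
Local Open Scope group_scope.

Definition pc_system c gs :=
  gpresents c gs && perm_eq (map (gword gs) (bits (size c))) (enum gT).

Lemma pc_systemP c gs : pc_system c gs ->
  [/\ {morph gword gs : x y / pc_mul c x y >-> x * y}, gword gs (pc_one c) = 1,
      {in bits (size c) &, injective (gword gs)} &
      forall g, exists2 x, x \in bits (size c) & g = gword gs x].
Proof.
case/andP=> pc pe; split.
- exact: pc_mulP.
- exact: gword0.
- by apply: uniq_map_inj; rewrite (perm_uniq pe) enum_uniq.
- by move=> g; apply/mapP; rewrite (perm_mem pe) mem_enum.
Qed.

(** Induction along a chain of subgroups normal in the whole group.  Normality in
    the whole group, and not just in the next member, is what makes every
    conjugation triangular: N and its coset K - N are both stable under it. *)
Lemma pc_series n (K : {group gT}) : 2.-group [set: gT] ->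
    K <| [set: gT] -> #|K| = (2 ^ n)%N ->
  exists c gs, [/\ c \in codes n, gpresents c gs,
    forall h, exists2 s, s \in triangular n &
      [seq g ^ h | g <- gs] = [seq gword gs t | t <- s]
    & perm_eq (map (gword gs) (bits n)) (enum K)].
Proof.
move=> pG; elim: n K => [|n IHn] K nK cK.
  exists [::], [::]; split=> // [h|]; first by exists [::].
  apply: enum_by_bits => // k.
  by rewrite (card1_trivg cK) => /set1P->; rewrite inE.
have [|N [sNK nN cN]] := normal_pgroup pG nK (r := n).
  by rewrite cK pfactorK.
have [c [gs [cc pc tc pe]]] := IHn N nN cN.
have memN k : k \in N -> exists2 x, x \in bits n & k = gword gs x.
  by rewrite -mem_enum -(perm_mem pe) => /mapP.
have [g Kg N'g] : exists2 g, g \in K & g \notin N.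
  apply/subsetPn; apply: contraL isT => /subset_leq_card.
  by rewrite cK cN leq_exp2l ?ltnn.
have coset k : k \in K -> k \notin N -> g^-1 * k \in N.
  move=> Kk N'k; rewrite -mem_lcoset.
  suffices -> : g *: N = K :\: N by rewrite inE N'k.
  apply/eqP; rewrite eqEcard; apply/andP; split; last first.
    by rewrite card_lcoset cardsD (setIidPr sNK) cK cN expnS mul2n -addnn addnK.
  apply/subsetP => x; rewrite mem_lcoset inE => Nx.
  have Kx : x \in K by rewrite -(groupMl x (groupVr Kg)) (subsetP sNK _ Nx).
  by rewrite Kx andbT; apply: contra N'g => xN; rewrite -groupV -(groupMr _ xN).
have [m bm gm] : exists2 m, m \in bits n & g * g = gword gs m.
  apply: memN; apply: contraR (N'g) => /coset; rewrite mulKg; apply.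
  exact: groupM.
have conjN k h : (k ^ h \in N) = (k \in N).
  by rewrite memJ_norm // (subsetP (normal_norm nN)) ?inE.
have tri h : exists2 s, s \in triangular n.+1 &
    [seq k ^ h | k <- g :: gs] = [seq gword (g :: gs) t | t <- s].
  have [s ts es] := tc h.
  have [|t bt et] := memN (g^-1 * g ^ h).
    apply: coset; last by rewrite conjN.
    by rewrite memJ_norm // (subsetP (normal_norm nK)) ?inE.
  exists ((true :: t) :: map (cons false) s).
    by apply/allpairsP; exists (t, s).
  by rewrite /= -et mulKVg es -map_comp.
have [s ts es] := tc g.
exists ((m, s) :: c), (g :: gs); split=> //.
- exact: mem_codesS.
- rewrite /= pc /step_relations gm eqxx !andbT /=; apply/eqP.
  have/(congr1 (map (mulg g))) := es; rewrite -!map_comp => <-.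
  by apply: eq_map => k /=; rewrite conjgE mulVKg.
- apply: enum_by_bits => // k Kk; rewrite map_cat -!map_comp mem_cat.
  have [/memN[x bx ->]|N'k] := boolP (k \in N); first by rewrite map_f.
  have [x bx ex] := memN _ (coset k Kk N'k).
  by apply/orP; right; apply/mapP; exists x => //=; rewrite -ex mulKVg.
Qed.

End PcSystems.

(** * Classification of the 2-groups of order at most 16 *)
Definition pc_gen n k : seq bool := mkseq (pred1 k) n.

(** Associativity on triples of generators, highest index first.  It is only used
    as a necessary condition, to discard codes. *)
Definition consistent (c : pc_code) :=
  let n := size c in let a := pc_gen n in
  all (fun k => all (fun j => all (fun i =>
    pc_mul c (pc_mul c (a k) (a j)) (a i)
      == pc_mul c (a k) (pc_mul c (a j) (a i)))
    (iota 0 j.+1)) (iota 0 k.+1)) (iota 0 n).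

(** Backtracking search, inside the group coded by c, for generators satisfying
    the relations of r, found from the last one up; k is the continuation.
    Requiring y to lie outside the subgroup generated so far prunes the search. *)
Fixpoint search (c r : pc_code) (k : seq (seq bool) -> bool) : bool :=
  if r is (m, s) :: r' then
    search c r' (fun ys => has (fun y =>
      [&& y \notin map (word (pc_mul c) (pc_one c) ys) (bits (size ys)),
        step_relations (pc_mul c) (pc_one c) m s y ys & k (y :: ys)])
      (bits (size c)))
  else k [::].

Definition has_system c r := search c r (fun ys =>
  all (mem (map (word (pc_mul c) (pc_one c) ys) (bits (size r)))) (bits (size c))).

Lemma searchP c r k : search c r k ->
  exists2 ys, presents (pc_mul c) (pc_one c) r ys & k ys.
Proof.
elim: r k => [|[m s] r IHr] k /=; first by exists [::].
case/IHr=> ys pys /hasP[y _ /and3P[_ rel ky]].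
by exists (y :: ys); rewrite //= rel.
Qed.

Section Classification.

Variable gT : finGroupType.
Implicit Types gs : seq gT.
Local Open Scope group_scope.

Lemma pc_system_assoc c gs : wf_code c -> pc_system c gs ->
  {in bits (size c) & &, associative (pc_mul c)}.
Proof.
move=> wc /pc_systemP[W _ injW _] x y z.
rewrite !mem_bits => /eqP sx /eqP sy /eqP sz.
apply: injW; rewrite ?mem_bits ?size_pc_mul //.
by rewrite !W mulgA.
Qed.

Lemma pc_system_consistent c gs : wf_code c -> pc_system c gs -> consistent c.
Proof.
move=> wc sc; do 3![apply/allP => ? _]; apply/eqP.
by rewrite (pc_system_assoc wc sc) // mem_bits size_mkseq.
Qed.

Lemma has_system_trans c r gs : size r = size c ->
  pc_system c gs -> has_system c r -> exists hs : seq gT, pc_system r hs.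
Proof.
move=> src sc /searchP[ys pys /allP onto].
have [W W1 _ surjW] := pc_systemP sc.
exists (map (gword gs) ys); rewrite /pc_system (presents_morph W1 W) //=.
rewrite -(eq_map (fun x => word_morph W1 W ys x)).
have /andP[_ pe] := sc.
apply: enum_by_bits => [|g _].
  by rewrite cardE -(perm_size pe) size_map size_bits src.
have [x bx ->] := surjW g.
by rewrite map_comp map_f //; apply: onto.
Qed.

Lemma pc_system_isog (hT : finGroupType) c (gs : seq gT) (hs : seq hT) :
  wf_code c -> pc_system c gs -> pc_system c hs -> [set: gT] \isog [set: hT].
Proof.
move=> wc /pc_systemP[Wg Wg1 injg surjg] /pc_systemP[Wh Wh1 injh surjh].
have [dec bdec decK] := fin_all_exists2 surjg.
have decE x : x \in bits (size c) -> dec (gword gs x) = x.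
  by move=> bx; apply: injg; rewrite -?decK.
pose f g := gword hs (dec g).
have fM : {in [set: gT] &, {morph f : x y / x * y}}.
  move=> g1 g2 _ _; rewrite /f -Wh {1}(decK g1) {1}(decK g2) -Wg decE //.
  by rewrite mem_bits size_pc_mul //; apply/eqP; rewrite -mem_bits.
apply/isogP; exists (Morphism fM).
  apply/injmP=> g1 g2 _ _ /= /injh e; rewrite (decK g1) (decK g2).
  by rewrite e.
apply/setP=> h; rewrite inE morphimEdom; apply/imsetP.
have [x bx ->] := surjh h.
by exists (gword gs x); rewrite ?inE //= /f decE.
Qed.

End Classification.

(** The number k stands for the k-th word of the appropriate length, that is, for
    the binary expansion of k with the topmost generator as leading digit. *)
Definition code_of (l : seq (nat * seq nat)) : pc_code :=
  foldr (fun p c => let w := nth [::] (bits (size c)) in (w p.1, map w p.2) :: c)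
        [::] l.

(** The trivial group; C2; C2^2, C4; C2^3, C4 x C2, C8, D8, Q8; C2^4,
    C4 x C2^2, C4^2, C8 x C2, C16, D8 x C2, (C4 x C2) : C2, the central product
    of D8 and C4, Q8 x C2, C4 : C4, the modular group of order 16, D16, SD16,
    Q16.  Among the many codes of each group, these keep the search short. *)
Definition representatives : seq pc_code := map code_of [::
  [::];
  [:: (0, [:: ])];
  [:: (0, [:: 1]); (0, [:: ])];
  [:: (1, [:: 1]); (0, [:: ])];
  [:: (0, [:: 2; 1]); (0, [:: 1]); (0, [:: ])];
  [:: (0, [:: 2; 1]); (1, [:: 1]); (0, [:: ])];
  [:: (2, [:: 2; 1]); (1, [:: 1]); (0, [:: ])];
  [:: (1, [:: 3; 1]); (0, [:: 1]); (0, [:: ])];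
  [:: (1, [:: 3; 1]); (1, [:: 1]); (0, [:: ])];
  [:: (0, [:: 4; 2; 1]); (0, [:: 2; 1]); (0, [:: 1]); (0, [:: ])];
  [:: (0, [:: 4; 2; 1]); (0, [:: 2; 1]); (1, [:: 1]); (0, [:: ])];
  [:: (2, [:: 4; 2; 1]); (1, [:: 2; 1]); (0, [:: 1]); (0, [:: ])];
  [:: (0, [:: 4; 2; 1]); (2, [:: 2; 1]); (1, [:: 1]); (0, [:: ])];
  [:: (4, [:: 4; 2; 1]); (2, [:: 2; 1]); (1, [:: 1]); (0, [:: ])];
  [:: (0, [:: 4; 2; 1]); (0, [:: 3; 1]); (1, [:: 1]); (0, [:: ])];
  [:: (3, [:: 6; 2; 1]); (1, [:: 2; 1]); (0, [:: 1]); (0, [:: ])];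
  [:: (1, [:: 5; 2; 1]); (0, [:: 3; 1]); (0, [:: 1]); (0, [:: ])];
  [:: (1, [:: 4; 3; 1]); (0, [:: 2; 1]); (1, [:: 1]); (0, [:: ])];
  [:: (1, [:: 5; 2; 1]); (2, [:: 2; 1]); (0, [:: 1]); (0, [:: ])];
  [:: (4, [:: 4; 3; 1]); (1, [:: 2; 1]); (0, [:: 1]); (0, [:: ])];
  [:: (2, [:: 6; 2; 1]); (0, [:: 3; 1]); (1, [:: 1]); (0, [:: ])];
  [:: (0, [:: 6; 3; 1]); (2, [:: 2; 1]); (1, [:: 1]); (0, [:: ])];
  [:: (2, [:: 6; 2; 1]); (1, [:: 3; 1]); (1, [:: 1]); (0, [:: ])]
].

(** The number of involutions (with 1) and the number of squares, isomorphism
    invariants that spare most of the fruitless searches. *)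
Definition profile (c : pc_code) :=
  let squares := [seq pc_mul c x x | x <- bits (size c)] in
  (count_mem (pc_one c) squares, size (undup squares)).

Definition classified n :=
  let rs := [seq (r, profile r) | r <- representatives & size r == n] in
  all (fun c => consistent c ==>
    (let p := profile c in has (fun r => (p == r.2) && has_system c r.1) rs))
  (codes n).

Lemma classification n c : n <= 4 -> c \in codes n -> consistent c ->
  exists r, [/\ r \in representatives, size r = n & has_system c r].
Proof.
(* Computed by call-by-need conversion: the search relies on a disjunction not
   evaluating its right-hand side once the left-hand side is true. *)
have: all classified (iota 0 5) by exact_no_check (erefl true).
move/allP/(_ n) => all_n le_n cc consc.
have /all_n/allP/(_ c cc) : n \in iota 0 5 by rewrite mem_iota.
rewrite consc implyTb => /hasP[p /mapP[r] + ->] /andP[_ rc].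
by rewrite mem_filter => /andP[/eqP sr rr]; exists r; split.
Qed.

Lemma representative_system (gT : finGroupType) :
    (2.-group [set: gT])%g -> #|[set: gT]| <= 16 ->
  exists2 r, r \in representatives & exists gs : seq gT, pc_system r gs.
Proof.
move=> pG le16; have [n cG] := p_natP pG.
have le_n : n <= 4 by rewrite -(leq_exp2l (m := 2)) // -cG.
have [c [gs [cc pc _ pe]]] := pc_series pG (normal_refl [set: gT]) cG.
have [sc wc] := codesP cc.
have sys : pc_system c gs.
  rewrite /pc_system pc sc (perm_trans pe) // uniq_perm ?enum_uniq // => g.
  by rewrite !mem_enum inE.
have [r [rr sr rc]] := classification le_n cc (pc_system_consistent wc sys).
by exists r => //; apply: has_system_trans sys rc; rewrite sr sc.
Qed.

(** * The unitary subgroup over the field of two elements *)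
Section GroupAlgebraF2.

Variable gT : finGroupType.
Local Notation FG := (groupAlg 'F_2 gT).
Local Notation V := (unitarySubgroup 'F_2 gT).
Implicit Types (x y : FG) (g h : gT) (u v : {unit FG}).
Local Open Scope ring_scope.

Lemma F2_double (a : 'F_2) : a + a = 0.
Proof. by rewrite addrr_pchar2 // pchar_Fp. Qed.

Lemma F2_sqr (a : 'F_2) : a * a = a.
Proof. by case: a => -[|[]] // i; apply/val_inj. Qed.

Lemma F2_natb (a : 'F_2) : a = (a != 0)%:R.
Proof. by case: a => -[|[]] // i; apply/val_inj. Qed.

Lemma ga_double x : x + x = 0.
Proof. by apply: gaP => g; rewrite ga_addE F2_double ffunE. Qed.

Lemma ga_augD x y : ga_aug (x + y) = ga_aug x + ga_aug y.
Proof. by rewrite -big_split; apply: eq_bigr => g _; rewrite ga_addE. Qed.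

Lemma ga_starD x y : ga_star (x + y) = ga_star x + ga_star y.
Proof. by have := ga_star_linear 1 x y; rewrite !scale1r. Qed.

Lemma ga_aug_star x : ga_aug (ga_star x) = ga_aug x.
Proof.
rewrite /ga_aug [RHS](reindex_inj invg_inj) /=.
by apply: eq_bigr => g _; rewrite ga_starE.
Qed.

Lemma ga_sqr1D y : (1 + y) * (1 + y) = 1 + y * y.
Proof. by rewrite mulrDl mul1r mulrDr mulr1 addrA -(addrA 1) ga_double addr0. Qed.

Lemma ga_ofI : injective (@ga_of 'F_2 gT).
Proof.
move=> g h /(congr1 (fun x : FG => x g)); rewrite !ga_ofE eqxx.
by case: eqP => // _ /eqP; rewrite oner_eq0.
Qed.

(** The augmentation condition is automatic: the augmentation of u times that of
    its image under the involution is its square, which over F_2 is itself. *)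
Lemma unitaryP u : reflect (val u * ga_star (val u) = 1) (u \in V).
Proof.
rewrite !inE; apply: (iffP andP) => [[_ /eqP <-]|uu1].
  by rewrite FinRing.val_unitV mulrV ?(valP u).
split; last first.
  rewrite FinRing.val_unitV -[X in _ == X]mul1r -(mulVr (valP u)).
  by rewrite -mulrA uu1 mulr1.
by rewrite -[ga_aug _]F2_sqr -{2}ga_aug_star -ga_augM uu1 ga_aug1.
Qed.

Lemma ga_of_unit g : ga_of 'F_2 g \is a GRing.unit.
Proof.
by apply/unitrP; exists (ga_of _ g^-1%g); rewrite -!ga_ofM mulgV mulVg ga_of1.
Qed.

Definition ga_unit g : {unit FG} := FinRing.unit FG (ga_of_unit g).

Lemma ga_unit_unitary g : ga_unit g \in V.
Proof. by apply/unitaryP; rewrite /= ga_star_of -ga_ofM mulgV ga_of1. Qed.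

Lemma symmetric_involution x : ga_star x = x -> x * x = 1 ->
  exists2 u, u \in V & (u ^+ 2 = 1)%g /\ val u = x.
Proof.
move=> xs xx; have Ux : x \is a GRing.unit by apply/unitrP; exists x.
exists (FinRing.unit FG Ux); first by apply/unitaryP; rewrite /= xs.
by split=> //; apply/val_inj; rewrite FinRing.val_unitX.
Qed.

Lemma involution_symmetric u : u \in V -> (u ^+ 2 = 1)%g ->
  ga_star (val u) = val u.
Proof.
move=> /unitaryP uu u2.
have uu1 : val u * val u = 1.
  by have /(congr1 val) := u2; rewrite FinRing.val_unitX.
by rewrite -[LHS]mul1r -uu1 -mulrA uu mulr1.
Qed.

Lemma ga_mulr_of x g h : (x * ga_of 'F_2 h) g = x (g * h^-1)%g.
Proof.
rewrite ga_mulE (bigD1 (g * h^-1)%g) //= big1 => [|k nk].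
  by rewrite addr0 ga_ofE invMg invgK mulgKV eqxx mulr1.
rewrite ga_ofE -(inj_eq (mulgI k)) mulKVg -(inj_eq (mulIg h^-1%g)) mulgK.
by rewrite eq_sym (negPf nk) mulr0.
Qed.

Lemma ga_mull_of x g h : (ga_of 'F_2 h * x) g = x (h^-1 * g)%g.
Proof.
rewrite ga_mulE (bigD1 h) //= big1 => [|k nk].
  by rewrite addr0 ga_ofE eqxx mul1r.
by rewrite ga_ofE (negPf nk) mul0r.
Qed.

(** The coefficient of x y at g is the sum over h of x(g h^-1) y(h), that of y x
    is the sum of y(h) x(h^-1 g), and h^-1 g is the conjugate of g h^-1 by h. *)
Lemma class_function_central x : (forall g h, x (g ^ h)%g = x g) ->
  forall y, x * y = y * x.
Proof.
move=> cx y; apply: gaP => g; rewrite !ga_mulE.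
have inj : injective (fun h => g * h^-1)%g by move=> h k /mulgI/invg_inj.
rewrite (reindex_inj inj); apply: eq_bigr => h _ /=.
by rewrite -(cx (g * h^-1)%g h) conjgE invMg invgK !mulgKV mulrC.
Qed.

Lemma ga_abelianP : reflect (forall g h, (g * h = h * g)%g) (abelian V).
Proof.
apply: (iffP centsP) => [cV g h | cG u _ v _].
  have /(congr1 val) := cV _ (ga_unit_unitary g) _ (ga_unit_unitary h).
  by rewrite /= -!ga_ofM => /ga_ofI.
apply/val_inj; rewrite !FinRing.val_unitM.
by apply: class_function_central => g h; rewrite conjgE cG mulgK.
Qed.

(** The Frobenius map: the cross terms of the square cancel in pairs, and the
    coefficients, being in F_2, are their own squares. *)
Lemma ga_sqr_commutative (a : gT -> 'F_2) (f : gT -> gT) :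
  (forall g h, (g * h = h * g)%g) ->
  let x : FG := \sum_g a g *: ga_of 'F_2 (f g) in
  x * x = \sum_g a g *: ga_of 'F_2 (f g * f g)%g.
Proof.
move=> cG /=; apply: (big_rec2 (fun x y : FG => x * x = y)) => [|g x y _ <-].
  by rewrite mul0r.
have xc z : x * z = z * x.
  by apply: class_function_central => h k; rewrite conjgE cG mulgK.
rewrite mulrDl !mulrDr addrA -(addrA (_ * _)) (xc (_ *: _)) ga_double addr0.
by rewrite -scalerAl -scalerAr scalerA F2_sqr ga_ofM.
Qed.

Lemma ga_exponent4P : (forall g h, (g * h = h * g)%g) ->
  (forall u, u \in V -> (u ^+ 4 = 1)%g) <-> (forall g, (g ^+ 4 = 1)%g).
Proof.
move=> cG; split=> [V4 g | G4 u /unitaryP uu].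
  have /(congr1 val) := V4 _ (ga_unit_unitary g).
  by rewrite FinRing.val_unitX /= !exprS mulr1 -!ga_ofM -ga_of1 => /ga_ofI.
apply/val_inj; rewrite FinRing.val_unitX /=.
have -> : val u ^+ 4 = (val u * val u) * (val u * val u) by rewrite -!mulrA.
rewrite {1 2 3 4}(ga_sum_of (val u)) !ga_sqr_commutative //.
transitivity (ga_aug (val u) *: 1 : FG); last first.
  by rewrite -[ga_aug _]F2_sqr -{2}ga_aug_star -ga_augM uu ga_aug1 scale1r.
rewrite /ga_aug scaler_suml; apply: eq_bigr => g _.
by rewrite -mulgA; have -> : (g * (g * (g * g)) = 1)%g := G4 g.
Qed.

Definition conj_pm (g h : gT) := (g ^ h == g)%g || (g ^ h == g^-1)%g.

(** An involution of V is symmetric, hence constant on each {g, g^-1} and here on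
    conjugacy classes. *)
Lemma involutions_central : (forall g h, conj_pm g h) ->
  forall u v, u \in V -> (u ^+ 2 = 1)%g -> commute u v.
Proof.
move=> dG u v Vu u2; apply/val_inj; rewrite !FinRing.val_unitM.
apply: class_function_central => g h.
by case/orP: (dG g h) => /eqP-> //; rewrite -ga_starE involution_symmetric.
Qed.

Lemma involution_not_central g h : (g ^+ 4 = 1)%g -> ~~ conj_pm g h ->
  exists u v, [/\ u \in V, v \in V, (u ^+ 2 = 1)%g & ~ commute u v].
Proof.
move=> g4 /norP[ng nVg]; have Vh := ga_unit_unitary h.
(* If g^2 = 1 then g itself serves; 1 + g + g^-1 would then be 1. *)
have [g2|g2] := eqVneq (g * g)%g 1%g.
  exists (ga_unit g), (ga_unit h); split; rewrite ?ga_unit_unitary //.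
    by apply/val_inj; rewrite FinRing.val_unitX /= expr2 -ga_ofM g2.
  move/(congr1 val); rewrite /= -!ga_ofM => /ga_ofI gh.
  by case/eqP: ng; rewrite conjgE gh mulKg.
pose x : FG := 1 + (ga_of 'F_2 g + ga_of 'F_2 g^-1%g).
have [||u Vu [u2 ux]] := @symmetric_involution x.
- by rewrite /x !ga_starD ga_star1 !ga_star_of invgK [ga_of _ g^-1%g + _]addrC.
- have gV2 : (g^-1 * g^-1 = g * g)%g.
    by apply: (mulgI (g * g)%g); rewrite -{1}invMg mulgV -mulgA -[LHS]g4.
  rewrite ga_sqr1D mulrDl !mulrDr -!ga_ofM gV2 mulgV mulVg.
  by rewrite [X in 1 + (X + _)]addrC ga_double addr0.
have xE k : x k = (k == 1%g)%:R + ((k == g)%:R + (k == g^-1%g)%:R).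
  by rewrite !ga_addE -ga_of1 !ga_ofE.
exists u, (ga_unit h); split=> // /(congr1 val).
rewrite /= ux => /(congr1 (fun y : FG => y (g * h)%g)).
rewrite ga_mulr_of ga_mull_of mulgK -conjgE !xE (negPf ng) (negPf nVg).
rewrite eqxx conjg_eq1 [g == g^-1%g]eq_mulgV1 invgK (negPf g2).
have /negPf-> : g != 1%g by apply: contraNneq g2 => ->; rewrite mulg1.
by rewrite !(add0r, addr0) => /eqP; rewrite oner_eq0.
Qed.

End GroupAlgebraF2.

(** * Functoriality *)
Section Functoriality.

Variables (gT hT : finGroupType) (f : gT -> hT).
Hypotheses (fM : {morph f : g h / (g * h)%g}) (f_bij : bijective f).
Local Notation FG := (groupAlg 'F_2 gT).
Local Notation FH := (groupAlg 'F_2 hT).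
Local Open Scope ring_scope.

Let fV g : f g^-1%g = (f g)^-1%g.
Proof.
apply: (mulgI (f g)); rewrite -fM !mulgV.
by apply: (mulgI (f 1%g)); rewrite -fM !mulg1.
Qed.

Definition ga_pull (x : FH) : FG := [ffun g => x (f g)].

Lemma ga_pullE x g : ga_pull x g = x (f g). Proof. exact: ffunE. Qed.

Lemma ga_pull_inj : injective ga_pull.
Proof.
move=> x y /ffunP exy; apply: gaP => h; have [k _ kK] := f_bij.
by have := exy (k h); rewrite !ga_pullE kK.
Qed.

Lemma ga_pullM x y : ga_pull (x * y) = ga_pull x * ga_pull y.
Proof.
apply: gaP => g; rewrite ga_pullE !ga_mulE (reindex f) /=; last exact: onW_bij.
by apply: eq_bigr => h _; rewrite !ga_pullE fM fV.
Qed.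

Lemma ga_pull1 : ga_pull 1 = 1.
Proof.
apply: gaP => g; rewrite ga_pullE -!ga_of1 !ga_ofE; congr (_ : bool)%:R.
by rewrite -(inj_eq (bij_inj f_bij)) -[in f 1%g](mulgV 1%g) fM fV mulgV.
Qed.

Lemma ga_pull_star x : ga_pull (ga_star x) = ga_star (ga_pull x).
Proof. by apply: gaP => g; rewrite ga_pullE !ga_starE ga_pullE fV. Qed.

Lemma ga_pull_unit (u : {unit FH}) : ga_pull (val u) \is a GRing.unit.
Proof.
apply/unitrP; exists (ga_pull (val u)^-1).
by rewrite -!ga_pullM mulVr ?mulrV ?ga_pull1 // (valP u).
Qed.

Definition unit_pull u : {unit FG} := FinRing.unit FG (ga_pull_unit u).

Lemma unit_pullM : {morph unit_pull : u v / (u * v)%g}.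
Proof.
by move=> u v; apply/val_inj; rewrite FinRing.val_unitM -ga_pullM.
Qed.

Lemma unit_pull_inj : injective unit_pull.
Proof. by move=> u v /(congr1 val)/ga_pull_inj/val_inj. Qed.

Lemma unit_pull_unitary u :
  u \in unitarySubgroup 'F_2 hT -> unit_pull u \in unitarySubgroup 'F_2 gT.
Proof.
move=> /unitaryP uu; apply/unitaryP.
by rewrite /= -ga_pull_star -ga_pullM uu ga_pull1.
Qed.

Lemma unitary_embedding :
  exists2 F : {morphism unitarySubgroup 'F_2 hT >-> {unit FG}},
    ('injm F)%g &
    (F @* unitarySubgroup 'F_2 hT)%g \subset unitarySubgroup 'F_2 gT.
Proof.
have pullM : {in unitarySubgroup 'F_2 hT &, {morph unit_pull : u v / (u * v)%g}}.
  exact: in2W unit_pullM.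
exists (Morphism pullM); first by apply/injmP => u v _ _ /unit_pull_inj.
by apply/subsetP => _ /morphimP[u Vu _ ->]; apply: unit_pull_unitary.
Qed.

End Functoriality.

Section UnitaryIsog.
Local Open Scope group_scope.

(** Each of the two groups embeds in the other, and both are finite. *)
Lemma unitary_isog (gT hT : finGroupType) : [set: gT] \isog [set: hT] ->
  unitarySubgroup 'F_2 gT \isog unitarySubgroup 'F_2 hT.
Proof.
have embed (g1 g2 : finGroupType) : [set: g1] \isog [set: g2] ->
    exists2 F : {morphism unitarySubgroup 'F_2 g2 >-> {unit groupAlg 'F_2 g1}},
    'injm F & F @* unitarySubgroup 'F_2 g2 \subset unitarySubgroup 'F_2 g1.
  case/isogP=> f injf imf.
  apply: (@unitary_embedding _ _ f) => [g h|]; first by rewrite morphM ?inE.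
  apply: inj_card_bij => [g h|].
    by apply: (injmP injf); rewrite inE.
  by rewrite -!cardsT -imf (card_injm injf).
move=> isoGH; have [F injF FH] := embed _ _ isoGH.
have [E injE EG] := embed _ _ (isog_symr isoGH).
rewrite isog_sym; apply/isogP; exists F => //; apply/eqP.
rewrite eqEcard FH card_injm //.
by rewrite -(card_injm injE (subxx _)) (subset_leq_card EG).
Qed.

End UnitaryIsog.

(** * Counting the zeros of the squaring map *)
Lemma eq_count_enum (T : finType) (S : {set T}) (P : pred T) :
  count P (enum S) = #|[set y in S | P y]|.
Proof.
rewrite -size_filter cardE; apply/perm_size/uniq_perm => [||y].
- exact/filter_uniq/enum_uniq.
- exact: enum_uniq.
by rewrite mem_filter !mem_enum inE andbC.
Qed.

(** Elements of the group algebra of a group of order 2^n, as perfect binary trees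
    whose leaves, the coefficients, are addressed by words. *)
Fixpoint vec n : Type := if n is n'.+1 then (vec n' * vec n')%type else bool.

Fixpoint vec0 n : vec n := if n is n'.+1 then (vec0 n', vec0 n') else false.

Fixpoint vec_add n : vec n -> vec n -> vec n :=
  if n is n'.+1 then fun v w => (vec_add v.1 w.1, vec_add v.2 w.2) else addb.

Fixpoint vec_null n : vec n -> bool :=
  if n is n'.+1 then fun v => vec_null v.1 && vec_null v.2 else negb.

Fixpoint vec_flip n : seq bool -> vec n -> vec n :=
  if n is n'.+1 then fun x v =>
    if head false x then (v.1, vec_flip (behead x) v.2)
    else (vec_flip (behead x) v.1, v.2)
  else fun _ b => ~~ b.

Definition vec_sum n (l : seq (seq bool)) : vec n :=
  foldr (@vec_flip n) (vec0 n) l.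

(** Counts the combinations z of a list of vectors e for which (y + z)^2 = 0.
    Here q is y^2, ds lists the e^2 + (y e + e y), and bs the brackets of each e
    with the later ones; passing from y to y + e adds the entry of ds to q and
    the brackets of e to the later entries of ds. *)
Fixpoint null_squares n (q : vec n) (ds : seq (vec n)) (bs : seq (seq (vec n))) :
    BinNums.N :=
  match ds, bs with
  | d :: ds', b :: bs' =>
    BinNat.N.add (null_squares q ds' bs')
      (null_squares (vec_add q d) [seq vec_add p.1 p.2 | p <- zip ds' b] bs')
  | _, _ => bin_of_nat (vec_null q)
  end.

Section Counting.

Variable R : nzRingType.
Hypothesis double0 : forall a : R, (a + a = 0)%R.
Local Open Scope ring_scope.

Fixpoint vec_val n : vec n -> (seq bool -> R) -> R :=
  if n is n'.+1 then
    fun v F => vec_val v.1 (F \o cons false) + vec_val v.2 (F \o cons true)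
  else fun b F => if b then F [::] else 0.

Lemma vec_val0 n F : vec_val (vec0 n) F = 0.
Proof. by elim: n F => //= n IHn F; rewrite !IHn addr0. Qed.

Lemma vec_valD n (v w : vec n) F :
  vec_val (vec_add v w) F = vec_val v F + vec_val w F.
Proof.
elim: n v w F => [|n IHn] v w F /=; last by rewrite !IHn addrACA.
by case: v w => [] []; rewrite ?addr0 ?add0r ?double0.
Qed.

Lemma vec_val_flip n x (v : vec n) F : size x = n ->
  vec_val (vec_flip x v) F = F x + vec_val v F.
Proof.
elim: n x v F => [[]|n IHn [|i x]] //= v F.
  by case: v; rewrite ?addr0 ?double0.
by move=> [sx]; case: i; rewrite /= IHn //; [rewrite addrCA | rewrite addrA].
Qed.

Lemma vec_val_sum n l F : all (fun x => size x == n) l ->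
  vec_val (vec_sum n l) F = \sum_(x <- l) F x.
Proof.
elim: l => [|x l IHl] /=; first by rewrite big_nil vec_val0.
by case/andP=> /eqP sx sl; rewrite big_cons vec_val_flip // IHl.
Qed.

Lemma map_vec_add (T : Type) n F (r : seq T) (a b : T -> R)
    (vs ws : seq (vec n)) :
    [seq vec_val v F | v <- vs] = map a r ->
    [seq vec_val w F | w <- ws] = map b r ->
  [seq vec_val v F | v <- [seq vec_add p.1 p.2 | p <- zip vs ws]] =
    [seq a t + b t | t <- r].
Proof.
elim: r vs ws => [|t r IHr] [|v vs] [|w ws] //= [va vsa] [wb wsb].
by rewrite vec_valD va wb IHr.
Qed.

Fixpoint commutators (es : seq R) : seq (seq R) :=
  if es is e :: es' then [seq e * e' + e' * e | e' <- es'] :: commutators es'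
  else [::].

Local Notation linear_comb es x := (word +%R 0 es x).

Lemma null_squaresP n F (es : seq R) (y : R) (q : vec n) ds bs :
    (forall v : vec n, vec_null v = (vec_val v F == 0)) ->
    vec_val q F = y * y ->
    [seq vec_val d F | d <- ds] = [seq e * e + (y * e + e * y) | e <- es] ->
    [seq [seq vec_val d F | d <- b] | b <- bs] = commutators es ->
  null_squares q ds bs =
    count (fun x => (y + linear_comb es x) * (y + linear_comb es x) == 0)
          (bits (size es)) :> nat.
Proof.
move=> nullE; elim: es y q ds bs => [|e es IHes] y q [|d ds] [|b bs] //=.
  by move=> qy _ _; rewrite !addr0 addn0 bin_of_natK nullE qy.
move=> qy [de dse] [be bse].
have NaddE a1 a2 : (BinNat.N.add a1 a2 : nat) = (a1 + a2)%N.
  by case: a1 a2 => [|p1] [|p2] //=; rewrite ?addn0 ?nat_of_add_pos.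
rewrite NaddE count_cat !count_map (IHes y) //; congr addn.
rewrite (IHes (y + e)) //.
- by apply: eq_count => x /=; rewrite !addrA.
- rewrite vec_valD qy de mulrDl !mulrDr -!addrA; congr (_ + _).
  by rewrite [LHS]addrC -addrA.
rewrite (map_vec_add dse be); apply: eq_map => e' /=.
by rewrite mulrDl mulrDr -!addrA; congr (_ + (_ + _)); rewrite addrCA.
Qed.

End Counting.

(** * Symmetric elements and involutions *)
Section SymmetricElements.

Variable gT : finGroupType.
Local Notation FG := (groupAlg 'F_2 gT).
Local Notation V := (unitarySubgroup 'F_2 gT).
Implicit Types (x : seq bool) (y z : FG) (g h : gT) (u v : {unit FG}).
Local Open Scope ring_scope.

Definition sym_ideal : {set FG} :=
  [set y | (ga_star y == y) && (ga_aug y == 0)].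

(** The bijection is u = 1 + y; over F_2 an element of square 1 has
    augmentation 1, so that y has augmentation 0. *)
Lemma card_involutions :
  #|[set u in V | (u ^+ 2 == 1)%g]| = #|[set y in sym_ideal | y * y == 0]|.
Proof.
pose f u : FG := 1 + val u.
have f_inj : injective f by move=> u v /addrI/val_inj.
rewrite -(card_imset _ f_inj); congr #|pred_of_set _|; apply/setP => y.
rewrite !inE.
apply/imsetP/idP => [[u + ->] | /andP[/andP[/eqP ys /eqP ya] /eqP yy]].
  rewrite inE => /andP[Vu /eqP u2].
  have uu : val u * val u = 1.
    by have /(congr1 val) := u2; rewrite FinRing.val_unitX.
  rewrite /f ga_sqr1D uu ga_starD ga_star1 (involution_symmetric Vu u2).
  rewrite ga_double !eqxx andbT /= ga_augD ga_aug1.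
  rewrite -[ga_aug (val u)]F2_sqr -ga_augM uu ga_aug1.
  by rewrite F2_double.
have [||u Vu [u2 uy]] := @symmetric_involution _ (1 + y).
- by rewrite ga_starD ga_star1 ys.
- by rewrite ga_sqr1D yy addr0.
exists u; first by rewrite inE Vu u2 /=.
by rewrite /f uy addrA ga_double add0r.
Qed.

(** Here s picks one element from each {g, g^-1} other than {1}. *)
Section HalfSystem.

Variable s : seq gT.
Hypothesis s_half :
  perm_eq (1%g :: s ++ [seq g^-1%g | g <- s & g^-1%g != g]) (enum gT).

Lemma sum_half (W : zmodType) (a : gT -> W) :
  \sum_g a g =
    a 1%g + \sum_(g <- s) a g + \sum_(g <- s | (g^-1 != g)%g) a g^-1%g.
Proof.
rewrite -big_enum -(perm_big _ s_half) /= big_cons big_cat big_map big_filter.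
by rewrite addrA.
Qed.

Lemma sum_sym_gen (W : lmodType 'F_2) (a : gT -> 'F_2) (b : gT -> W) :
  \sum_(g <- s) a g *: (b g + b (if g^-1 == g then 1 else g^-1)%g) =
    \sum_(g <- s) a g *: b g +
    ((\sum_(g <- s | (g^-1 == g)%g) a g) *: b 1%g +
     \sum_(g <- s | (g^-1 != g)%g) a g *: b g^-1%g).
Proof.
rewrite (eq_bigr _ (fun g _ => scalerDr _ _ _)) big_split /=; congr (_ + _).
rewrite (bigID (fun g => g^-1 == g)%g) /= scaler_suml.
by congr (_ + _); apply: eq_bigr => g; case: ifP.
Qed.

Definition sym_gen g : FG :=
  ga_of 'F_2 g + ga_of 'F_2 (if g^-1 == g then 1 else g^-1)%g.

Local Notation sym_comb := (word +%R 0 (map sym_gen s)).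

Lemma sym_gen_coef g h : g \in s -> h \in s -> sym_gen g h = (g == h)%:R.
Proof.
move=> sg sh; rewrite ga_addE !ga_ofE eq_sym.
have := enum_uniq gT; rewrite -(perm_uniq s_half) /= mem_cat negb_or cat_uniq.
case/andP=> /andP[s1 _] /and3P[_ /hasPn disj _].
case: ifP => [|/negbT gV].
  by rewrite [h == _](_ : _ = false) ?addr0 //; apply: contraNF s1 => /eqP<-.
have /disj /= : g^-1%g \in [seq g^-1%g | g <- s & g^-1%g != g].
  by rewrite map_f // mem_filter gV.
by case: (h =P g^-1%g) => [<-|]; rewrite ?sh ?addr0.
Qed.

(** The coordinates of a combination are its coefficients on s. *)
Lemma sym_comb_coef x : size x = size s -> [seq sym_comb x g != 0 | g <- s] = x.
Proof.
have := enum_uniq gT; rewrite -(perm_uniq s_half) /= cat_uniq => /and3P[_ Us _].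
have: {in s &, forall g h, sym_gen g h = (g == h)%:R}.
  by move=> *; apply: sym_gen_coef.
elim: s x Us => [|g r IHr] [|b x] //= /andP[r'g Ur] coef [sx].
have coefr : {in r &, forall g h, sym_gen g h = (g == h)%:R}.
  by move=> h k rh rk; apply: coef; rewrite inE ?rh ?rk orbT.
have ng h : h \in r -> (g == h) = false.
  by move=> rh; apply: contraNF r'g => /eqP->.
have wg : word +%R 0 (map sym_gen r) x g = 0.
  apply/eqP; apply: (word_ind (P := fun y : FG => y g == 0)).
  - by rewrite ffunE.
  - by move=> y z /eqP yg /eqP zg; rewrite /= ga_addE yg zg addr0.
  rewrite all_map; apply/allP => h rh /=; rewrite coef ?inE ?eqxx ?rh ?orbT //.
  by rewrite [h == g]eq_sym ng.
congr (_ :: _).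
  case: b => /=; last by rewrite wg eqxx.
  by rewrite ga_addE wg coef ?inE ?eqxx.
rewrite -[RHS]IHr //; apply/eq_in_map => h rh; case: b => //.
by rewrite ga_addE coef ?inE ?eqxx ?rh ?orbT // ng // add0r.
Qed.

(** Only the coefficient at 1 is not visibly matched; augmentation 0 forces it to
    be the sum of the coefficients at the involutions of s, because those at
    g and g^-1 cancel when g^2 <> 1. *)
Lemma sym_comb_decomp y : y \in sym_ideal ->
  sym_comb [seq y g != 0 | g <- s] = y.
Proof.
rewrite inE => /andP[/eqP ys /eqP ya].
have yV g : y g^-1%g = y g by rewrite -ga_starE ys.
have combE : sym_comb [seq y g != 0 | g <- s] = \sum_(g <- s) y g *: sym_gen g.
  elim: (s) => [|g r IHr] /=; first by rewrite big_nil.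
  rewrite big_cons IHr [in RHS](F2_natb (y g)).
  by case: (_ != _); rewrite ?scale1r ?scale0r ?add0r.
pose P := \sum_(g <- s | (g^-1 == g)%g) y g.
have y1 : y 1%g = P.
  have e : y 1%g + P = 0.
    rewrite -ya /ga_aug sum_half (bigID (fun g => g^-1 == g)%g) /= -/P.
    under [X in _ = _ + X]eq_bigr => g _ do rewrite yV.
    by rewrite -!addrA F2_double addr0.
  by rewrite -[LHS]addr0 -(F2_double P) addrA e add0r.
rewrite combE sum_sym_gen -/P -y1 [RHS]ga_sum_of sum_half.
under [X in _ = _ + X]eq_bigr => g _ do rewrite yV.
by rewrite addrA [_ *: _ + _]addrC.
Qed.

Lemma sym_comb_ideal x : sym_comb x \in sym_ideal.
Proof.
apply: (word_ind (P := fun y => y \in sym_ideal)).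
- rewrite inE; apply/andP; split; apply/eqP.
    by apply: gaP => g; rewrite ga_starE !ffunE.
  by rewrite /ga_aug big1 // => g _; rewrite ffunE.
- move=> y z; rewrite !inE => /andP[/eqP ys /eqP ya] /andP[/eqP zs /eqP za].
  by rewrite ga_starD ys zs ga_augD ya za addr0 !eqxx.
apply/allP => _ /mapP[g _ ->]; rewrite inE /sym_gen ga_augD !ga_aug_of.
rewrite F2_double eqxx andbT ga_starD !ga_star_of.
case: ifP => [/eqP->|_]; first by rewrite invg1.
by rewrite invgK addrC.
Qed.

Lemma sym_ideal_enum :
  perm_eq (map (fun x => sym_comb x) (bits (size s))) (enum sym_ideal).
Proof.
apply: uniq_perm => [||y]; first 2 last.
- rewrite mem_enum; apply/mapP/idP => [[x _ ->]|/sym_comb_decomp <-].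
    exact: sym_comb_ideal.
  by exists [seq y g != 0 | g <- s]; rewrite // mem_bits size_map.
- rewrite map_inj_in_uniq ?bits_uniq // => x1 x2.
  rewrite !mem_bits => /eqP s1 /eqP s2.
  move/(congr1 (fun y : FG => [seq y g != 0 | g <- s])).
  by rewrite !sym_comb_coef.
exact: enum_uniq.
Qed.

Lemma card_involutions_half :
  #|[set u in V | (u ^+ 2 == 1)%g]| =
    count (fun x => sym_comb x * sym_comb x == 0) (bits (size s)).
Proof.
rewrite card_involutions -eq_count_enum.
by rewrite -(seq.permP sym_ideal_enum) count_map.
Qed.

End HalfSystem.
End SymmetricElements.

(** * The invariants of the unitary subgroup computed from a code *)
Definition pc_inv (c : pc_code) x :=
  let bs := bits (size c) in
  nth [::] bs (find (fun y => pc_mul c x y == pc_one c) bs).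

Definition half_system (c : pc_code) :=
  foldr (fun x s => if pc_inv c x \in s then s else x :: s) [::]
        (behead (bits (size c))).

Definition half_system_ok c := perm_eq
  (pc_one c :: half_system c
     ++ [seq pc_inv c x | x <- half_system c & pc_inv c x != x])
  (bits (size c)).

(** The support of the basis vector [sym_gen] attached to x. *)
Definition pairing c x :=
  [:: x; if pc_inv c x == x then pc_one c else pc_inv c x].

Definition products c (e f : seq (seq bool)) :=
  [seq pc_mul c x y | x <- e, y <- f].

Fixpoint brackets c n (es : seq (seq (seq bool))) : seq (seq (vec n)) :=
  if es is e :: es' then
    [seq vec_sum n (products c e f ++ products c f e) | f <- es']
      :: brackets c n es'
  else [::].

Definition involution_count (c : pc_code) :=
  let n := size c in let es := map (pairing c) (half_system c) in
  null_squares (vec0 n) [seq vec_sum n (products c e e) | e <- es]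
               (brackets c n es).

Definition pc_all (c : pc_code) (P : pred (seq bool)) := all P (bits (size c)).

Definition pc_abelian c :=
  pc_all c (fun x => pc_all c (fun y => pc_mul c x y == pc_mul c y x)).

Definition pc_pow4_eq1 c x := let y := pc_mul c x x in pc_mul c y y == pc_one c.

Definition pc_conj_pm c x y :=
  let z := pc_mul c x y in (z == pc_mul c y x) || (z == pc_mul c y (pc_inv c x)).

Definition pc_dedekind c := pc_all c (fun x => pc_all c (pc_conj_pm c x)).

Definition pc_bad_conj c :=
  ~~ pc_all c (fun x => pc_pow4_eq1 c x ==> pc_all c (pc_conj_pm c x)).

Definition signature c :=
  (involution_count c, pc_abelian c, pc_abelian c && pc_all c (pc_pow4_eq1 c),
   pc_dedekind c).

(** The last clause says that the group falls under [involutions_central] or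
    [involution_not_central]. *)
Definition admissible c :=
  [&& wf_code c, half_system_ok c & pc_dedekind c || pc_bad_conj c].

Lemma representatives_admissible : all admissible representatives.
Proof. exact_no_check (erefl true). Qed.

Lemma signatures_uniq : uniq (map signature representatives).
Proof. exact_no_check (erefl true). Qed.

Section GroupInvariants.
Local Open Scope group_scope.

Definition group_invariants (gT : finGroupType) (K : {group gT}) :=
  (#|[set u in K | u ^+ 2 == 1]|, abelian K, abelian K && (exponent K %| 4),
   [forall u in K, (u ^+ 2 == 1) ==> [forall v in K, u * v == v * u]]).

Lemma isog_invariants (gT hT : finGroupType) (K : {group gT}) (L : {group hT}) :
  K \isog L -> group_invariants K = group_invariants L.
Proof.
move=> isoKL; rewrite /group_invariants.
rewrite (isog_abelian isoKL) (exponent_isog isoKL).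
have [f injf fK] := isogP isoKL.
have f2 u : u \in K -> (f u ^+ 2 == 1) = (u ^+ 2 == 1).
  by move=> Ku; rewrite -morphX // morph_injm_eq1 // groupX.
have fC u v : u \in K -> v \in K -> (f u * f v == f v * f u) = (u * v == v * u).
  by move=> Ku Kv; rewrite -!morphM // (inj_in_eq (injmP injf)) // groupM.
have memL v : reflect (exists2 u, u \in K & v = f u) (v \in L).
  by rewrite -fK morphimEdom; apply: imsetP.
congr (_, _, _, _).
  rewrite -(card_in_imset (f := f)); last first.
    by move=> u v /setIdP[Ku _] /setIdP[Kv _]; apply: (injmP injf).
  apply: eq_card => v; rewrite inE.
  apply/imsetP/andP => [[u /setIdP[Ku u2] ->]|[]].
    by rewrite f2 // u2; split=> //; apply/memL; exists u.
  by case/memL=> u Ku ->; rewrite f2 // => u2; exists u; rewrite // inE Ku.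
apply/forall_inP/forall_inP => centK u => [/memL[v Kv ->]|Ku].
  rewrite f2 //; apply/implyP => /(implyP (centK v Kv))/forall_inP cv.
  by apply/forall_inP => _ /memL[w Kw ->]; rewrite fC // cv.
have Lf v : v \in K -> f v \in L by move=> Kv; apply/memL; exists v.
apply/implyP => u2; have := centK _ (Lf u Ku); rewrite f2 // u2 => /forall_inP cu.
by apply/forall_inP => v Kv; rewrite -fC // cu // Lf.
Qed.

End GroupInvariants.

Lemma vec_val_support (gT : finGroupType) n (f : seq bool -> gT) (v : vec n) g :
  g \notin map f (bits n) ->
  (vec_val v (fun x => ga_of 'F_2 (f x)) : groupAlg 'F_2 gT) g = 0%R.
Proof.
elim: n f v => [|n IHn] f v /=.
  by rewrite inE => /negPf ng; case: v; rewrite ?ga_ofE ?ng ?ffunE.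
rewrite map_cat mem_cat negb_or -!map_comp => /andP[n0 n1].
by rewrite ga_addE (IHn (f \o cons false)) // (IHn (f \o cons true)) // addr0.
Qed.

(** The values of f being distinct, the group elements they index are linearly
    independent: the two halves of a tree have disjoint supports. *)
Lemma vec_null_val (gT : finGroupType) n (f : seq bool -> gT) (v : vec n) :
    {in bits n &, injective f} ->
  vec_null v = (vec_val v (fun x => ga_of 'F_2 (f x)) == 0%R :> groupAlg 'F_2 gT).
Proof.
elim: n f v => [|n IHn] f v injf /=.
  case: v; rewrite ?eqxx //=; apply/esym/negP => /eqP/(congr1 (@ga_aug 'F_2 gT)).
  by rewrite ga_aug_of /ga_aug big1 // => g _; rewrite ffunE.
have inj_cons b : {in bits n &, injective (f \o cons b)}.
  move=> x y; rewrite !mem_bits => sx sy /injf; rewrite !(mem_bits n.+1) => e.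
  by have [] := e sx sy.
rewrite (IHn (f \o cons false)) // (IHn (f \o cons true)) //.
pose a : groupAlg 'F_2 gT := vec_val v.1 (fun x => ga_of 'F_2 (f (false :: x))).
pose b : groupAlg 'F_2 gT := vec_val v.2 (fun x => ga_of 'F_2 (f (true :: x))).
change ((a == 0%R) && (b == 0%R) = ((a + b)%R == 0%R)).
apply/andP/eqP => [[/eqP-> /eqP->]|ab]; first by rewrite addr0.
have ab0 g : (a g + b g = 0)%R by rewrite -ga_addE ab ffunE.
have a0 : a = 0%R.
  apply: gaP => g; rewrite [RHS]ffunE.
  have [/mapP[x bx gx]|/vec_val_support-> //] :=
    boolP (g \in map (f \o cons false) (bits n)).
  suffices b0 : b g = 0%R by rewrite -(ab0 g) b0 addr0.
  apply: vec_val_support; apply/mapP => -[y by_]; rewrite gx => /injf.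
  by rewrite !mem_bits /= !eqSS -!mem_bits => /(_ bx by_).
by rewrite a0 eqxx -[b]add0r -[X in (X + b)%R]a0 ab eqxx.
Qed.

Section Tables.

Variables (gT : finGroupType) (c : pc_code) (gs : seq gT).
Hypotheses (wc : wf_code c) (sys : pc_system c gs).
Local Notation n := (size c).
Local Notation W := (gword gs).
Local Notation V := (unitarySubgroup 'F_2 gT).

Let WM : {morph W : x y / pc_mul c x y >-> (x * y)%g}.
Proof. by case: (pc_systemP sys). Qed.

Let W1 : W (pc_one c) = 1%g.
Proof. by case: (pc_systemP sys). Qed.

Let Winj : {in bits n &, injective W}.
Proof. by case: (pc_systemP sys). Qed.

Let Wsurj g : exists2 x, x \in bits n & g = W x.
Proof. by case: (pc_systemP sys). Qed.

Let bits1 : pc_one c \in bits n.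
Proof. by rewrite mem_bits size_nseq. Qed.

Let bitsM x y : x \in bits n -> y \in bits n -> pc_mul c x y \in bits n.
Proof. by rewrite !mem_bits => /eqP sx /eqP sy; rewrite size_pc_mul. Qed.

Let eqW x y : x \in bits n -> y \in bits n -> (x == y) = (W x == W y).
Proof. by move=> bx by_; rewrite (inj_in_eq Winj). Qed.

Lemma pc_invP x : x \in bits n ->
  pc_inv c x \in bits n /\ W (pc_inv c x) = (W x)^-1%g.
Proof.
move=> bx; have [y by_ xy] := Wsurj (W x)^-1%g.
have has_inv : has (fun y => pc_mul c x y == pc_one c) (bits n).
  by apply/hasP; exists y => //; rewrite eqW ?bitsM // WM -xy mulgV W1.
split; first by rewrite mem_nth // -has_find.
have := nth_find [::] has_inv; rewrite -/(pc_inv c x) => /eqP/(congr1 W).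
by rewrite WM W1 => /(canRL (mulKg _)) ->; rewrite mulg1.
Qed.

Lemma pc_allP (P : pred (seq bool)) (Q : gT -> Prop) :
    (forall x, x \in bits n -> reflect (Q (W x)) (P x)) ->
  reflect (forall g, Q g) (pc_all c P).
Proof.
move=> PQ; apply: (iffP allP) => [allP_ g | allQ x bx]; last exact/PQ.
by have [x bx ->] := Wsurj g; apply/PQ/allP_.
Qed.

Lemma pc_abelianP : reflect (forall g h : gT, (g * h = h * g)%g) (pc_abelian c).
Proof.
apply: (@pc_allP _ (fun g => forall h, (g * h = h * g)%g)) => x bx.
apply: (@pc_allP _ (fun h => (W x * h = h * W x)%g)) => y by_.
by rewrite eqW ?bitsM // !WM; apply: eqP.
Qed.

Lemma pc_pow4P x : x \in bits n -> reflect (W x ^+ 4 = 1)%g (pc_pow4_eq1 c x).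
Proof.
move=> bx; rewrite /pc_pow4_eq1 eqW ?bitsM // !WM W1 -mulgA.
exact: eqP.
Qed.

Lemma pc_exponent4P :
  reflect (forall g : gT, g ^+ 4 = 1)%g (pc_all c (pc_pow4_eq1 c)).
Proof. exact: (@pc_allP _ (fun g => g ^+ 4 = 1)%g pc_pow4P). Qed.

Lemma pc_conj_pmP x y : x \in bits n -> y \in bits n ->
  reflect (conj_pm (W x) (W y)) (pc_conj_pm c x y).
Proof.
move=> bx by_; have [bV WV] := pc_invP bx.
have conjE k : (W x ^ W y == k)%g = (W x * W y == W y * k)%g.
  by rewrite conjgE -(inj_eq (mulgI (W y))) mulKVg.
by rewrite /pc_conj_pm !eqW ?bitsM // !WM WV /conj_pm !conjE; apply: idP.
Qed.

Lemma pc_dedekindP : reflect (forall g h : gT, conj_pm g h) (pc_dedekind c).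
Proof.
apply: (@pc_allP _ (fun g => forall h, conj_pm g h)) => x bx.
by apply: (@pc_allP _ (fun h => conj_pm (W x) h)) => y; apply: pc_conj_pmP.
Qed.

Lemma pc_bad_conjP :
  pc_bad_conj c -> exists g h : gT, (g ^+ 4 = 1)%g /\ ~~ conj_pm g h.
Proof.
move=> /allPn[x bx].
rewrite negb_imply => /andP[/(pc_pow4P bx) x4 /allPn[y by_ nxy]].
by exists (W x), (W y); split=> //; apply: contra nxy => /pc_conj_pmP->.
Qed.

Lemma involution_countP : half_system_ok c ->
  #|[set u in V | (u ^+ 2 == 1)%g]| = involution_count c :> nat.
Proof.
move=> ok; have okm := perm_mem ok.
have half_bits x : x \in half_system c -> x \in bits n.
  by move=> hx; rewrite -okm inE mem_cat hx orbT.
pose s := map W (half_system c).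
have s_half : perm_eq (1%g :: s ++ [seq g^-1%g | g <- s & g^-1%g != g]) (enum gT).
  have /andP[_ pe] := sys; apply: perm_trans pe.
  apply: perm_trans (perm_map W ok).
  rewrite /= W1 map_cat filter_map -!map_comp.
  have -> : [seq x <- half_system c | pc_inv c x != x] =
      [seq x <- half_system c | preim W (fun g => g^-1%g != g) x].
    apply: eq_in_filter => x /half_bits bx /=.
    by have [bV WV] := pc_invP bx; rewrite eqW // WV.
  set r := filter _ _.
  have -> : map (W \o pc_inv c) r = map (@invg gT \o W) r; last exact: perm_refl.
  by apply/eq_in_map => x; rewrite mem_filter => /andP[_ /half_bits /pc_invP[_]].
rewrite (card_involutions_half s_half) size_map.
pose F x : groupAlg 'F_2 gT := ga_of 'F_2 (W x).
pose E e := (\sum_(x <- e) F x)%R.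
have val_products e f : (\sum_(x <- products c e f) F x = E e * E f)%R.
  rewrite big_flatten big_map /E big_distrlr /=; apply: eq_bigr => x _.
  by rewrite big_map; apply: eq_bigr => y _; rewrite /F WM ga_ofM.
have size_products e f : {subset e <= bits n} -> {subset f <= bits n} ->
    all (fun x => size x == n) (products c e f).
  move=> se sf; apply/allP => _ /allpairsP[[x y] /= [xe yf ->]].
  by rewrite -mem_bits; apply: bitsM (se _ xe) (sf _ yf).
pose es := map (pairing c) (half_system c).
have es_bits : {in es, forall e, {subset e <= bits n}}.
  move=> _ /mapP[x /half_bits bx ->] y; rewrite !inE => /orP[/eqP-> //|/eqP->].
  by case: ifP => // _; have [] := pc_invP bx.
have EE : map E es = map (@sym_gen gT) s.
  rewrite -!map_comp; apply/eq_in_map => x /half_bits bx /=.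
  rewrite /E !big_cons big_nil addr0 /F /sym_gen; have [bV WV] := pc_invP bx.
  by rewrite eqW // WV; case: ifP; rewrite ?W1 ?WV.
rewrite /involution_count -/es; clearbody es.
rewrite (@null_squaresP (groupAlg 'F_2 gT) (@ga_double gT) _ F (map E es) 0%R).
- by rewrite EE !size_map; apply: eq_count => x; rewrite !add0r.
- by move=> v; apply: vec_null_val.
- by rewrite vec_val0 mulr0.
- rewrite -!map_comp; apply/eq_in_map => e ee /=.
  have be := es_bits e ee.
  rewrite (vec_val_sum (@ga_double gT)) ?size_products //.
  by rewrite val_products mul0r mulr0 !addr0.
elim: es es_bits {EE} => //= e es IHes bes.
rewrite IHes => [|f ef]; last by apply: bes; rewrite inE ef orbT.
congr (_ :: _); rewrite -!map_comp; apply/eq_in_map => f ef /=.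
have [be bf] : {subset e <= bits n} /\ {subset f <= bits n}.
  by split; apply: bes; rewrite inE ?eqxx ?ef ?orbT.
rewrite (vec_val_sum (@ga_double gT)) ?all_cat ?size_products //.
by rewrite big_cat /= !val_products.
Qed.

Lemma invariants_signature : admissible c ->
  group_invariants (unitarySubgroup_group 'F_2 gT) =
    ((signature c).1.1.1 : nat, pc_abelian c, (signature c).1.2, pc_dedekind c).
Proof.
case/and3P=> _ ok dw; congr (_, _, _, _).
- exact: involution_countP.
- by apply/idP/idP => [/ga_abelianP/pc_abelianP | /pc_abelianP/ga_abelianP].
- apply/andP/andP => -[]; [move/ga_abelianP | move/pc_abelianP] => cG.
    move/exponentP=> V4; split; first exact/pc_abelianP.
    by apply/pc_exponent4P/ga_exponent4P.
  move=> /pc_exponent4P/(ga_exponent4P cG) V4; split; first exact/ga_abelianP.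
  exact/exponentP.
apply/forall_inP/idP => [centV | /pc_dedekindP dG u Vu].
  apply: contraTT dw => nd; rewrite (negPf nd) /=.
  apply/negP => /pc_bad_conjP[g [h [g4 ngh]]].
  have [u [v [Vu Vv u2 nuv]]] := involution_not_central g4 ngh.
  by have := centV u Vu; rewrite u2 eqxx => /forall_inP/(_ v Vv)/eqP.
apply/implyP => /eqP u2; apply/forall_inP => v _; apply/eqP.
exact: involutions_central.
Qed.

End Tables.

(** Distinct representatives have distinct signatures. *)
Lemma nth_signature r : r \in representatives ->
  r = nth [::] representatives
          (index (signature r) (map signature representatives)).
Proof.
move=> rr; rewrite -{2}(nth_index [::] rr).
rewrite -(nth_map _ (signature [::])) ?index_mem //.
by rewrite index_uniq ?nth_index ?size_map ?index_mem ?signatures_uniq.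
Qed.

(** * The isomorphism theorem *)
Theorem theorem3 (gT hT : finGroupType)
  (pG : (2.-group [set: gT])%g) (leG : (#|[set: gT]| <= 16)%N)
  (pH : (2.-group [set: hT])%g) (leH : (#|[set: hT]| <= 16)%N) :
  (unitarySubgroup 'F_2 gT \isog unitarySubgroup 'F_2 hT)%g
  <-> ([set: gT] \isog [set: hT])%g.
Proof.
split=> [isoV|]; last exact: unitary_isog.
have [r rr [gs sysG]] := representative_system pG leG.
have [t tt [hs sysH]] := representative_system pH leH.
have ar := allP representatives_admissible r rr.
have at_ := allP representatives_admissible t tt.
have /and3P[wr _ _] := ar; have /and3P[wt _ _] := at_.
have := @isog_invariants _ _ (unitarySubgroup_group 'F_2 gT)
  (unitarySubgroup_group 'F_2 hT) isoV.
rewrite (invariants_signature wr sysG ar) (invariants_signature wt sysH at_).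
case=> /(can_inj nat_of_binK) e1 e2 e3 e4.
have ert : signature r = signature t.
  by rewrite /signature; congr (_, _, _, _); [apply: e1 | | apply: e3 |].
have ert' : r = t by rewrite [LHS](nth_signature rr) [RHS](nth_signature tt) ert.
by rewrite -ert' in sysH; apply: pc_system_isog wr sysG sysH.
Qed.
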